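(* Let $n$ be a positive integer, $k\in\{1,\dots,n\}$, and let $A,B\colon[0,1]^n\to[0,1]$ be standardized functions with $A\le B$. Suppose that at least one of the functions $A$ and $B$ satisfies Condition S. Then the following statements are equivalent: (i) There exists a $k$-increasing function $C\colon[0,1]^n\to[0,1]$ such that $A\le C\le B$. (ii) For all $\mathbf R\in\mathcal R_k([0,1]^n)$: $L_k^{(A,B)}(\mathbf R)\ge 0$.
   Context: Write $\mathbb I=[0,1]$; $\le$ between functions is the pointwise order, and ''increasing'' means non-decreasing. Boxes. For $\mathbf x,\mathbf y\in\mathbb I^n$, the product $R=[\mathbf x,\mathbf y]=\prod_{i=1}^n[x_i,y_i]$ is a $k$-box if $x_i<y_i$ for exactly $k$ indices $i$ and $x_i=y_i$ for the remaining $n-k$ indices. Its vertices are $\operatorname{ver}R=\prod_{i=1}^n\{x_i,y_i\}$. The sign of a vertex $\mathbf v$ is $\operatorname{sign}_R(\mathbf v)=(-1)^{m-(n-k)}$, where $m=|\{i: v_i=x_i\}|$. The multiplicity of $\mathbf u\in\mathbb I^n$ with respect to $R$ is $m_R(\mathbf u)=\operatorname{sign}_R(\mathbf u)$ if $\mathbf u\in\operatorname{ver}R$ and $0$ otherwise. $\mathcal R_k(\mathbb I^n)$ is the set of formal finite disjoint unions $\mathbf R=\bigsqcup_{j=1}^s R_j$ of $k$-boxes with vertices in $\mathbb I^n$, i.e. finite families (multisets) of $k$-boxes, where repetitions and overlaps are allowed; $m_{\mathbf R}(\mathbf u)=\sum_{j=1}^s m_{R_j}(\mathbf u)$. For functions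 $A\le B$ on $\mathbb I^n$, $$L_k^{(A,B)}(\mathbf R)=\sum_{\mathbf y:\,m_{\mathbf R}(\mathbf y)>0}m_{\mathbf R}(\mathbf y)B(\mathbf y)+\sum_{\mathbf y:\,m_{\mathbf R}(\mathbf y)<0}m_{\mathbf R}(\mathbf y)A(\mathbf y)$$ (finite sums over $\mathbf y\in\mathbb I^n$). Functions. $f\colon\mathbb I^n\to\mathbb I$ is $k$-increasing if $\sum_{\mathbf v\in\operatorname{ver}R}\operatorname{sign}_R(\mathbf v)f(\mathbf v)\ge0$ for every $k$-box $R$ in $\mathbb I^n$ ($1$-increasing means increasing in each variable); grounded if $f(\mathbf x)=0$ whenever some $x_i=0$; standardized if it is grounded, $1$-increasing and $f(1,\dots,1)=1$. Condition S. $f\colon\mathbb I^n\to\mathbb I$ satisfies Condition S if there is a countable set $S\subseteq\mathbb I$ such that for every $\mathbf u\in\mathbb I^n$ and every $i\in\{1,\dots,n\}$ the set of discontinuities of the section $t\mapsto f(u_1,\dots,u_{i-1},t,u_{i+1},\dots,u_n)$ is contained in $S$. *)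

(* Defs.v *)
From HB Require Import structures.
From mathcomp Require Import all_boot all_order all_algebra.
From mathcomp Require Import all_classical all_reals all_analysis.

Set Implicit Arguments.
Unset Strict Implicit.
Unset Printing Implicit Defensive.

Import Order.TTheory GRing.Theory Num.Theory.
Import numFieldNormedType.Exports.

Local Open Scope classical_set_scope.
Local Open Scope ring_scope.

(* A function on [0,1]^n is a total function on 'rV[R]_n; every predicate below
   looks only at its values on [cube]. *)
Definition cube (R : realType) (n : nat) : set 'rV[R]_n :=
  [set x | forall i, 0 <= x ord0 i <= 1].

Definition unit_valued (R : realType) (n : nat) (f : 'rV[R]_n -> R) : Prop :=
  forall x, cube x -> 0 <= f x <= 1.

Definition le_on_cube (R : realType) (n : nat) (f g : 'rV[R]_n -> R) : Prop :=
  forall x, cube x -> f x <= g x.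

(* The box [x, y] is represented by the pair (x, y) of its extreme corners. *)
Definition box (R : realType) (n : nat) : Type := ('rV[R]_n * 'rV[R]_n)%type.

Definition is_kbox (R : realType) (n k : nat) (Q : box R n) : Prop :=
  [/\ cube Q.1, cube Q.2,
      (forall i, Q.1 ord0 i <= Q.2 ord0 i)
    & #|[pred i | Q.1 ord0 i < Q.2 ord0 i]| = k].

Definition ver (R : realType) (n : nat) (Q : box R n) : set 'rV[R]_n :=
  [set v | forall i, v ord0 i = Q.1 ord0 i \/ v ord0 i = Q.2 ord0 i].

(* The natural-number subtractions are exact: k <= n for a k-box, and a vertex
   agrees with Q.1 on the n - k degenerate coordinates. *)
Definition box_sign (R : realType) (n k : nat) (Q : box R n) (v : 'rV[R]_n)
    : int :=
  (-1) ^+ (#|[pred i | v ord0 i == Q.1 ord0 i]| - (n - k))%N.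

Definition box_mult (R : realType) (n k : nat) (Q : box R n) (u : 'rV[R]_n)
    : int :=
  if u \in ver Q then box_sign k Q u else 0.

(* The multiset of boxes is given by a list; only the multiplicities, which do
   not depend on the order, are ever used. *)
Definition is_kbox_family (R : realType) (n k : nat) (Rs : seq (box R n))
    : Prop :=
  forall Q : box R n, Q \in Rs -> is_kbox k Q.

Definition family_mult (R : realType) (n k : nat) (Rs : seq (box R n))
    (u : 'rV[R]_n) : int :=
  \sum_(Q <- Rs) box_mult k Q u.

(* Both index sets are finite, and contained in [cube] for a family of k-boxes,
   so the sums over all of 'rV[R]_n are finite sums over [0,1]^n. *)
Definition L (R : realType) (n k : nat) (A B : 'rV[R]_n -> R)
    (Rs : seq (box R n)) : R :=
  \sum_(y \in [set y | 0 < family_mult k Rs y])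
     (family_mult k Rs y)%:~R * B y
  + \sum_(y \in [set y | family_mult k Rs y < 0])
     (family_mult k Rs y)%:~R * A y.

Definition k_increasing (R : realType) (n k : nat) (f : 'rV[R]_n -> R)
    : Prop :=
  forall Q : box R n, is_kbox k Q ->
    0 <= \sum_(v \in ver Q) (box_sign k Q v)%:~R * f v.

Definition grounded (R : realType) (n : nat) (f : 'rV[R]_n -> R) : Prop :=
  forall x, cube x -> (exists i, x ord0 i = 0) -> f x = 0.

Definition standardized (R : realType) (n : nat) (f : 'rV[R]_n -> R) : Prop :=
  [/\ grounded f, k_increasing 1 f & f (const_mx 1) = 1].

Definition update (R : realType) (n : nat) (u : 'rV[R]_n) (i : 'I_n) (t : R)
    : 'rV[R]_n :=
  \row_j (if j == i then t else u ord0 j).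

(* Continuity of g : [0,1] -> R, i.e. one-sided at the endpoints. *)
Definition discontinuities (R : realType) (g : R -> R) : set R :=
  [set t : R | `[0, 1]%classic t /\
               ~ (g @ within `[0, 1]%classic (nbhs t) --> g t)].

Definition condition_S (R : realType) (n : nat) (f : 'rV[R]_n -> R) : Prop :=
  exists S : set R,
    [/\ S `<=` `[0, 1]%classic, countable S
      & forall (u : 'rV[R]_n) (i : 'I_n), cube u ->
          discontinuities (fun t => f (update u i t)) `<=` S].

(* Main.v *)
Require Import Defs.
From HB Require Import structures.
From mathcomp Require Import all_boot all_order all_algebra.
From mathcomp Require Import all_classical all_reals all_analysis.
From mathcomp Require Import ring.

Set Implicit Arguments.
Unset Strict Implicit.
Unset Printing Implicit Defensive.

Import Order.TTheory GRing.Theory Num.Theory.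

Local Open Scope ring_scope.

(** This is a Hahn-Banach statement. For numbers a and b, max (m a) (m b)
is sublinear in the multiplicity m and equals m b or m a, according to the sign
of m, when a <= b; so L is sublinear in the multiplicity function. If L >= 0 on
the cone of multiplicities of k-box families, then the values of A and B at one
point can be replaced by a common value c without losing L >= 0: the lower
bounds on c come from families of positive multiplicity at the point, the upper
bounds from families of negative multiplicity, and a lower bound exceeding an
upper bound is excluded by a combination of the two families whose multiplicity
at the point vanishes. Zorn's lemma then yields such a choice at every point. *)

(** * Sublinear envelopes of finitely supported integer functions *)

Section Envelope.
Local Open Scope classical_set_scope.
Local Open Scope ring_scope.
Context {R : realType} {T : choiceType}.
Implicit Types (A B C : T -> R) (f g : T -> int) (s : seq T) (x y : T).

Definition finitely_supported f := finite_set [set y | f y != 0].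

(** The max keeps the formula sublinear in [f] even off the cube, where [A] and [B] may be in either
    order. *)
Definition envelope A B f : R :=
  \sum_(y \in [set: T]) Num.max ((f y)%:~R * A y) ((f y)%:~R * B y).

Lemma finitely_supportedP f :
  finitely_supported f -> exists2 s, uniq s & forall y, y \notin s -> f y = 0.
Proof.
move=> /finite_seqP[s sE]; exists (undup s); first exact: undup_uniq.
move=> y; rewrite mem_undup => ys; apply/eqP/negPn/negP => fy.
have : [set` s] y by rewrite -sE.
by rewrite /= (negbTE ys).
Qed.

Lemma finitely_supported_seq s f :
  (forall y, y \notin s -> f y = 0) -> finitely_supported f.
Proof.
move=> sf; apply: (@sub_finite_set _ _ [set` s]).
  move=> y /= fy; apply/negPn/negP => /sf fy0.
  by rewrite fy0 eqxx in fy.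
exact: finite_seq.
Qed.

Lemma fsbig_seq_support (D : set T) (F : T -> R) s :
  uniq s -> (forall y, D y -> y \notin s -> F y = 0) ->
  \sum_(y \in D) F y = \sum_(y <- s | y \in D) F y.
Proof.
move=> us sF; rewrite fsbig_mkcond (fsbigE s) //=.
  rewrite big_mkcond [RHS]big_mkcond; apply: eq_bigr => y _.
  by rewrite in_setT /patch.
move=> y _ ys; rewrite /patch; case: ifPn => // /set_mem Dy.
exact: sF.
Qed.

(** Any duplicate-free list containing the support serves, so several envelopes can be expanded over
    a common list. *)
Lemma envelopeE A B f s : uniq s -> (forall y, y \notin s -> f y = 0) ->
  envelope A B f =
  \sum_(y <- s) Num.max ((f y)%:~R * A y) ((f y)%:~R * B y).
Proof.
move=> us sf; rewrite /envelope (fsbig_seq_support us).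
  by apply: eq_bigl => y; rewrite in_setT.
by move=> y _ /sf ->; rewrite !mul0r maxxx.
Qed.

Lemma envelope_mono A B C f :
  finitely_supported f -> (forall y, f y != 0 -> A y <= C y <= B y) ->
  envelope C C f <= envelope A B f.
Proof.
move=> /finitely_supportedP[s us sf] ACB.
rewrite !(envelopeE _ _ us sf); apply: ler_sum => y _; rewrite maxxx le_max.
have [f0|f0|->] := ltgtP (f y) 0; last by rewrite !mul0r lexx.
  have /ACB/andP[AC _] : f y != 0 by rewrite lt_eqF.
  by rewrite ler_wnM2l// lerz0 ltW.
have /ACB/andP[_ CB] : f y != 0 by rewrite gt_eqF.
by rewrite orbC ler_wpM2l// ler0z ltW.
Qed.

(** The coefficients are natural numbers because families of boxes can only be repeated and
    concatenated. *)
Definition combine f g (p q : nat) : T -> int :=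
  fun y => f y *+ p + g y *+ q.

Lemma intr_combine f g p q y :
  (combine f g p q y)%:~R = p%:R * (f y)%:~R + q%:R * (g y)%:~R :> R.
Proof.
rewrite /combine rmorphD /= !rmorphMn /=.
by rewrite -[_ *+ p]mulr_natl -[_ *+ q]mulr_natl.
Qed.

(** Holds term by term: max is subadditive and commutes with nonnegative factors. *)
Lemma envelope_combine A B f g p q :
  finitely_supported f -> finitely_supported g ->
  envelope A B (combine f g p q) <=
  p%:R * envelope A B f + q%:R * envelope A B g.
Proof.
move=> /finitely_supportedP[s us sf] /finitely_supportedP[t ut tg].
pose r := undup (s ++ t).
have rst y : y \notin r -> y \notin s /\ y \notin t.
  by rewrite mem_undup mem_cat negb_or => /andP[].
have ur : uniq r by exact: undup_uniq.
have rf y : y \notin r -> f y = 0 by move=> /rst[/sf].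
have rg y : y \notin r -> g y = 0 by move=> /rst[_ /tg].
have rfg y : y \notin r -> combine f g p q y = 0.
  by move=> yr; rewrite /combine rf// rg// !mul0rn addr0.
rewrite (envelopeE _ _ ur rf) (envelopeE _ _ ur rg) (envelopeE _ _ ur rfg).
rewrite !mulr_sumr -big_split; apply: ler_sum => y _.
rewrite intr_combine.
rewrite !maxr_pMr ?ler0n// ge_max !mulrDl -!mulrA.
by rewrite !lerD// le_max lexx ?orbT.
Qed.

Definition update_at A x c : T -> R := fun y => if y == x then c else A y.

Lemma update_at_id A x : update_at A x (A x) = A.
Proof. by apply/funext => y; rewrite /update_at; case: eqP => [->|]. Qed.

(** Isolates the dependence on the values at [x]; the value 0 there removes that point from the
    first summand. *)
Lemma envelope_update A B f x a b : finitely_supported f ->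
  envelope (update_at A x a) (update_at B x b) f =
  envelope (update_at A x 0) (update_at B x 0) f +
  Num.max ((f x)%:~R * a) ((f x)%:~R * b).
Proof.
move=> /finitely_supportedP[s us sf].
pose r := undup (x :: s).
have ur : uniq r by exact: undup_uniq.
have rf y : y \notin r -> f y = 0.
  by rewrite mem_undup inE negb_or => /andP[_ /sf].
have xr : x \in r by rewrite mem_undup mem_head.
rewrite !(envelopeE _ _ ur rf) !(bigD1_seq x xr ur) /=.
have ux C d : update_at C x d x = d by rewrite /update_at eqxx.
rewrite !ux !mulr0 maxxx add0r addrC; congr (_ + _).
by apply: eq_bigr => y /negbTE yx; rewrite /update_at yx.
Qed.

(** * Extension to a single value at every point *)

Section Extension.
Variable M : set (T -> int).
Hypothesis M_combine :
  forall f g p q, M f -> M g -> M (combine f g p q).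
Hypothesis M_finite : forall f, M f -> finitely_supported f.

Definition envelope_ge0 A B := forall f, M f -> 0 <= envelope A B f.

Lemma choose_value A B x : envelope_ge0 A B ->
  exists c, Num.min (A x) (B x) <= c <= Num.max (A x) (B x) /\
    envelope_ge0 (update_at A x c) (update_at B x c).
Proof.
move=> AB0; set a := A x; set b := B x.
(* The terms away from [x]: a value [c] is suitable when [0 <= rest f + f x * c] for all [f] in
   [M]. *)
pose rest f := envelope (update_at A x 0) (update_at B x 0) f.
have restE f : M f ->
    0 <= rest f + Num.max ((f x)%:~R * a) ((f x)%:~R * b).
  move=> Mf; rewrite -envelope_update; last exact: M_finite.
  by rewrite !update_at_id; exact: AB0.
have rest0 f : M f -> f x = 0 -> 0 <= rest f.
  by move=> /restE + fx; rewrite fx !mul0r maxxx addr0.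
(* The lower bounds on [c]; [min a b] makes the set nonempty and keeps its supremum in range. *)
pose E : set R := [set c | c = Num.min a b \/
  exists f, [/\ M f, 0 < f x & c = - rest f / (f x)%:~R]].
have E_min : E (Num.min a b) by left.
have E_max : ubound E (Num.max a b).
  move=> _ [->|[f [Mf fx ->]]]; first by rewrite ge_min le_max lexx.
  have fx0 : 0 < (f x)%:~R :> R by rewrite ltr0z.
  rewrite ler_pdivrMr// mulrC maxr_pMr ?(ltW fx0)//.
  by rewrite -subr_ge0 opprK addrC restE.
have E_neg f : M f -> f x < 0 -> ubound E (rest f / - (f x)%:~R).
  move=> Mf fx; have fx0 : (f x)%:~R < 0 :> R by rewrite ltrz0.
  have nfx0 : 0 < - (f x)%:~R :> R by rewrite oppr_gt0.
  move=> _ [->|[g [Mg gx ->]]]; rewrite ler_pdivlMr//.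
    rewrite mulrN -subr_ge0 opprK mulrC minr_nMr ?(ltW fx0)//.
    exact: restE.
  have gx0 : 0 < (g x)%:~R :> R by rewrite ltr0z.
  rewrite mulrAC ler_pdivrMr//.
  (* As [f x < 0 < g x], the natural multipliers [|g x|] for [f] and [|f x|] for [g] cancel the
     multiplicity at [x]. *)
  have fE : `|f x|%N%:R = - (f x)%:~R :> R.
    by rewrite pmulrn -ltr0_norm// -intr_norm abszE.
  have gE : `|g x|%N%:R = (g x)%:~R :> R.
    by rewrite pmulrn -[RHS]gtr0_norm// -intr_norm abszE.
  have Mh : M (combine f g `|g x|%N `|f x|%N) by exact: M_combine.
  have /(rest0 _ Mh) h0 : combine f g `|g x|%N `|f x|%N x = 0.
    by apply: (@intr_inj R); rewrite intr_combine fE gE; ring.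
  (* Sublinearity yields [0 <= |g x| * rest f + |f x| * rest g], which is the goal with denominators
     cleared. *)
  have := le_trans h0 (envelope_combine _ _ _ _ (M_finite Mf) (M_finite Mg)).
  rewrite fE gE -/(rest f) -/(rest g) => h.
  rewrite -subr_ge0; apply: le_trans h _; rewrite le_eqVlt; apply/orP; left.
  by apply/eqP; ring.
have E_sup : ubound E (sup E).
  by move=> c Ec; apply: ub_le_sup => //; exists (Num.max a b).
have E_ne : E !=set0 by exists (Num.min a b).
exists (sup E); split; first by rewrite E_sup//= ge_sup.
move=> f Mf; rewrite envelope_update ?maxxx; last exact: M_finite.
rewrite -/(rest f); case: (ltgtP (f x) 0) => fx.
- have fx0 : (f x)%:~R < 0 :> R by rewrite ltrz0.
  have := ge_sup E_ne (E_neg _ Mf fx).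
  by rewrite ler_pdivlMr ?oppr_gt0// mulrN -subr_ge0 opprK [_ * sup E]mulrC.
- have fx0 : 0 < (f x)%:~R :> R by rewrite ltr0z.
  have : - rest f / (f x)%:~R <= sup E by apply: E_sup; right; exists f.
  by rewrite ler_pdivrMr// -subr_ge0 opprK addrC [_ * sup E]mulrC.
- by rewrite fx mul0r addr0 rest0.
Qed.

(* A partial choice of values is a graph; points without a value keep the bounds
   given by A and B. *)
Definition fill A (G : set (T * R)) : T -> R :=
  fun x => xget (A x) [set c | G (x, c)].

Definition admissible A B (G : set (T * R)) : Prop :=
  [/\ forall x c d, G (x, c) -> G (x, d) -> c = d,
      forall x c, G (x, c) -> Num.min (A x) (B x) <= c <= Num.max (A x) (B x)
    & envelope_ge0 (fill A G) (fill B G)].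

Lemma fill_mem A G x c :
  (forall x c d, G (x, c) -> G (x, d) -> c = d) -> G (x, c) -> fill A G x = c.
Proof. by move=> Gf Gc; apply: xget_unique => // d /(Gf _ _ _ Gc). Qed.

Lemma fill_notin A G x : ~ (exists c, G (x, c)) -> fill A G x = A x.
Proof. by move=> nG; rewrite /fill xgetPN// => c Gc; apply: nG; exists c. Qed.

Lemma eq_fill A G H x :
  (forall c, G (x, c) <-> H (x, c)) -> fill A G x = fill A H x.
Proof.
move=> GH; rewrite /fill; congr xget.
by apply/seteqP; split => c /= /GH.
Qed.

(** Each point of [s] that has a value gets it from some member of the chain, and the largest of
    these finitely many members serves for all of [s]. The empty graph covers the case where no
    point of [s] has a value. *)
Lemma chain_local (F : set (set (T * R))) s : total_on F subset ->
  (forall G, F G -> forall x c d, G (x, c) -> G (x, d) -> c = d) ->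
  exists G, [/\ G = set0 \/ F G &
    forall x c, x \in s -> (\bigcup_(X in F) X) (x, c) <-> G (x, c)].
Proof.
move=> totF funF.
suff [G [FG sG]] : exists G : set (T * R), (G = set0 \/ F G) /\
    forall x c, x \in s -> (\bigcup_(X in F) X) (x, c) -> G (x, c).
  exists G; split=> // x c xs; split; first exact: sG.
  by case: FG => [->//|FG Gxc]; exists G.
elim: s => [|y s [G [FG sG]]]; first by exists set0; split; [left|].
have [[d [H FH Hd]]|nd] :=
    pselect (exists d, (\bigcup_(X in F) X) (y, d)); last first.
  exists G; split=> // x c; rewrite inE => /predU1P[->|xs]; last exact: sG.
  by move=> yc; case: nd; exists c.
have [K [FK GK HK]] : exists K, [/\ F K, (G `<=` K) & (H `<=` K)].
  case: FG => [->|FG]; first by exists H; split.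
  by have [GH|HG] := totF _ _ FG FH; [exists H; split|exists G; split].
exists K; split; first by right.
move=> x c; rewrite inE => /predU1P[->|xs /(sG _ _ xs)/GK//] [X FX Xc].
(* If [X] contains [K], it holds both [c] and [d] at [y], and functionality of [X] forces them to be
   equal. *)
have [XK|KX] := totF _ _ FX FK; first exact: XK.
have /(funF _ FX _ _ _ Xc) -> := KX _ (HK _ Hd).
exact: HK.
Qed.

(** An envelope sees only the finite support of [f], where the union agrees with a single member of
    the chain or with the empty graph. *)
Lemma admissible_bigcup A B (F : set (set (T * R))) : envelope_ge0 A B ->
  (F `<=` admissible A B) -> total_on F subset ->
  admissible A B (\bigcup_(X in F) X).
Proof.
move=> AB0 FP totF.
have funF G : F G -> forall x c d, G (x, c) -> G (x, d) -> c = d.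
  by move=> /FP[].
split.
- move=> x c d [G FG Gc] [H FH Hd].
  have [GH|HG] := totF _ _ FG FH; first exact: (funF _ FH _ _ _ (GH _ Gc)).
  exact: (funF _ FG _ _ _ Gc (HG _ Hd)).
- by move=> x c [G /FP[_ + _]] => /[apply].
- move=> f Mf; have /finitely_supportedP[s us sf] := M_finite Mf.
  have [G [FG sG]] := chain_local s totF funF.
  have -> : envelope (fill A (\bigcup_(X in F) X))
      (fill B (\bigcup_(X in F) X)) f = envelope (fill A G) (fill B G) f.
    rewrite !(envelopeE _ _ us sf); apply: eq_big_seq => y ys.
    by rewrite !(eq_fill _ (fun c => sG y c ys)).
  case: FG => [->|/FP[_ _]]; last exact.
  have fill0 C : fill C set0 = C.
    by apply/funext => y; rewrite fill_notin// => -[].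
  by rewrite !fill0; exact: AB0.
Qed.

Lemma envelope_sandwich A B : envelope_ge0 A B ->
  exists C, (forall x, Num.min (A x) (B x) <= C x <= Num.max (A x) (B x)) /\
    envelope_ge0 C C.
Proof.
move=> AB0.
have [G [[Gfun Grange G0] Gmax]] :=
  Zorn_bigcup (fun F => @admissible_bigcup A B F AB0).
have Gtot x : exists c, G (x, c).
  apply: contrapT => nG.
  have [c [crange c0]] := choose_value x G0.
  rewrite !fill_notin// in crange.
  (* A point without a value would let the maximal graph grow by one pair. *)
  pose H := (G `|` [set (x, c)]).
  have HE y d : H (y, d) <-> if y == x then d = c else G (y, d).
    case: eqP => [->|yx]; split.
    - by case=> [Gd|[]//]; case: nG; exists d.
    - by move=> ->; right.
    - by case=> // -[/yx].
    - by left.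
  have fillH C : fill C H = update_at (fill C G) x c.
    apply/funext => y; rewrite /update_at; case: (eqVneq y x) => [->|yx].
      by apply: xget_unique => [|d] /=; rewrite HE eqxx.
    by apply: eq_fill => d; rewrite HE (negbTE yx).
  apply: (Gmax H); last first.
    split; last by rewrite !fillH.
    - move=> y d e; rewrite !HE; case: eqP => [_ -> ->//|_]; exact: Gfun.
    - by move=> y d; rewrite HE; case: eqP => [-> ->//|_]; exact: Grange.
  split; first by left.
  by move=> /(_ (x, c)) HG; apply: nG; exists c; apply: HG; right.
exists (fill A G); split=> [x|].
  by have [c Gc] := Gtot x; rewrite (fill_mem _ Gfun Gc); exact: Grange.
(* The graph is total, so filling [A] and filling [B] give the same function. *)
have -> // : envelope_ge0 (fill A G) (fill A G) =
    envelope_ge0 (fill A G) (fill B G).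
congr envelope_ge0; apply/funext => x.
by have [c Gc] := Gtot x; rewrite !(fill_mem _ Gfun Gc).
Qed.

End Extension.
End Envelope.

(** * Multiplicities of families of boxes *)

Section BoxFamilies.
Context {R : realType} {n k : nat}.
Implicit Types (A B C : 'rV[R]_n -> R) (Q : box R n) (Rs : seq (box R n)).

Lemma finite_ver Q : finite_set (ver Q).
Proof.
(* A vertex is determined by the set of coordinates where it agrees with the lower corner. *)
pose v (D : {set 'I_n}) : 'rV[R]_n :=
  \row_i (if i \in D then Q.1 ord0 i else Q.2 ord0 i).
apply: (@sub_finite_set _ _ (range v)); last exact: finite_image.
move=> u Qu; exists [set i | u ord0 i == Q.1 ord0 i]%SET => //.
apply/rowP => i; rewrite mxE inE; case: eqP => [->//|ui].
by case: (Qu i).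
Qed.

Lemma ver_cube Q : is_kbox k Q -> (ver Q `<=` cube (R:=R) (n:=n))%classic.
Proof. by case=> c1 c2 _ _ v Qv i; case: (Qv i) => ->. Qed.

Lemma box_mult_notin Q u : ~ ver Q u -> box_mult k Q u = 0.
Proof. by move=> Qu; rewrite /box_mult memNset. Qed.

Lemma family_mult_cat Rs Rs' u :
  family_mult k (Rs ++ Rs') u = family_mult k Rs u + family_mult k Rs' u.
Proof. by rewrite /family_mult big_cat. Qed.

Lemma family_mult_nseq Rs p u :
  family_mult k (flatten (nseq p Rs)) u = family_mult k Rs u *+ p.
Proof.
elim: p => [|p IHp] /=; first by rewrite /family_mult big_nil.
by rewrite family_mult_cat IHp mulrS.
Qed.

Lemma finitely_supported_family_mult Rs :
  finitely_supported (family_mult k Rs).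
Proof.
apply: (@sub_finite_set _ _ (\bigcup_(Q in [set` Rs]) ver Q)%classic).
  move=> u /=; apply: contra_neqP => nu.
  rewrite /family_mult big_seq big1// => Q QRs.
  by rewrite box_mult_notin// => Qu; apply: nu; exists Q.
by apply: bigcup_finite => // Q _; exact: finite_ver.
Qed.

Lemma family_mult_cube Rs u : is_kbox_family k Rs -> family_mult k Rs u != 0 ->
  cube u.
Proof.
move=> kRs; apply: contra_neqP => nu; rewrite /family_mult big_seq big1// => Q.
by move=> /kRs kQ; rewrite box_mult_notin// => /(ver_cube kQ).
Qed.

(** The sign of the multiplicity decides which term attains the max; multiplicities vanish off the
    cube, so [A <= B] on the cube suffices. *)
Lemma L_envelope A B Rs : is_kbox_family k Rs -> le_on_cube A B ->
  L k A B Rs = envelope A B (family_mult k Rs).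
Proof.
move=> kRs AB.
have [s us sf] := finitely_supportedP (finitely_supported_family_mult Rs).
rewrite (envelopeE _ _ us sf) /L.
rewrite !(fsbig_seq_support us); last 2 first.
- by move=> y _ /sf ->; rewrite mul0r.
- by move=> y _ /sf ->; rewrite mul0r.
rewrite big_mkcond [X in _ + X]big_mkcond -big_split; apply: eq_bigr => y _ /=.
have memE (P : pred 'rV[R]_n) : (y \in [set y | P y]%classic) = P y.
  by apply/idP/idP; rewrite inE.
rewrite !memE; set m := family_mult k Rs y.
have [m0|m0|->] := ltgtP m 0; last by rewrite !mul0r addr0 maxxx.
  have /AB ABy : cube y by apply: (family_mult_cube kRs); rewrite lt_eqF.
  by rewrite add0r max_l// ler_wnM2l// lerz0 ltW.
have /AB ABy : cube y by apply: (family_mult_cube kRs); rewrite gt_eqF.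
by rewrite addr0 max_r// ler_wpM2l// ler0z ltW.
Qed.

(** With equal bounds the envelope is linear, so the sums over points and over boxes can be
    exchanged. *)
Lemma envelope_diag C Rs : envelope C C (family_mult k Rs) =
  \sum_(Q <- Rs) \sum_(v \in ver Q) (box_sign k Q v)%:~R * C v.
Proof.
have /finite_seqP[t tE] : finite_set (\bigcup_(Q in [set` Rs]) ver Q)%classic.
  by apply: bigcup_finite => // Q _; exact: finite_ver.
(* All vertices are listed, including those whose signs cancel in the family. *)
pose s := undup t; have us : uniq s by exact: undup_uniq.
have sver Q : Q \in Rs -> (ver Q `<=` [set` s])%classic.
  move=> QRs v Qv; rewrite /= mem_undup.
  have : (\bigcup_(Q in [set` Rs]) ver Q)%classic v by exists Q.
  by rewrite tE.
have sf y : y \notin s -> family_mult k Rs y = 0.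
  move=> ys; rewrite /family_mult big_seq big1// => Q /sver sQ.
  by rewrite box_mult_notin// => /sQ /=; rewrite (negbTE ys).
rewrite (envelopeE _ _ us sf).
under eq_bigr do rewrite maxxx /family_mult rmorph_sum mulr_suml.
rewrite exchange_big /= big_seq [RHS]big_seq; apply: eq_bigr => Q /sver sQ.
rewrite (fsbig_seq_support us); last by move=> v /sQ /= ->.
rewrite [RHS]big_mkcond; apply: eq_bigr => v _.
by rewrite /box_mult; case: ifP => // _; rewrite mul0r.
Qed.

Lemma family_mult_combine Rs Rs' p q :
  is_kbox_family k Rs -> is_kbox_family k Rs' ->
  exists2 Rs'', is_kbox_family k Rs'' &
    family_mult k Rs'' = combine (family_mult k Rs) (family_mult k Rs') p q.
Proof.
move=> kRs kRs'; exists (flatten (nseq p Rs) ++ flatten (nseq q Rs')).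
  move=> Q; rewrite mem_cat => /orP[] /flattenP[s /nseqP[-> _]].
    exact: kRs.
  exact: kRs'.
by apply/funext => u; rewrite family_mult_cat !family_mult_nseq.
Qed.

End BoxFamilies.

(** * The two implications *)

Theorem theorem3p1 (R : realType) (n k : nat) (A B : 'rV[R]_n -> R)
  (hn : (0 < n)%N) (hk : (1 <= k <= n)%N)
  (hA : unit_valued A) (hB : unit_valued B)
  (sA : standardized A) (sB : standardized B)
  (hAB : le_on_cube A B)
  (hS : condition_S A \/ condition_S B) :
  (exists C : 'rV[R]_n -> R,
     [/\ unit_valued C, k_increasing k C, le_on_cube A C & le_on_cube C B])
  <->
  (forall Rs : seq (box R n), is_kbox_family k Rs -> 0 <= L k A B Rs).
Proof.
split=> [[C [_ Ck AC CB]] Rs kRs|L0].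
  rewrite L_envelope//.
  apply: (@le_trans _ _ (envelope C C (family_mult k Rs))).
    rewrite envelope_diag big_seq; apply: sumr_ge0 => Q QRs.
    exact: Ck (kRs _ QRs).
  apply: envelope_mono; first exact: finitely_supported_family_mult.
  by move=> y /(family_mult_cube kRs) cy; rewrite AC// CB.
(* The cone of multiplicity functions on which [L] is nonnegative. *)
pose M : set ('rV[R]_n -> int) :=
  [set family_mult k Rs | Rs in [set Rs | is_kbox_family k Rs]]%classic.
have M_combine f g p q : M f -> M g -> M (combine f g p q).
  move=> [Rs kRs <-] [Rs' kRs' <-].
  by have [Rs'' kRs'' <-] := family_mult_combine p q kRs kRs'; exists Rs''.
have M_finite f : M f -> finitely_supported f.
  by move=> [Rs _ <-]; exact: finitely_supported_family_mult.
have AB0 : envelope_ge0 M A B.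
  by move=> _ [Rs kRs <-]; rewrite -L_envelope//; exact: L0.
have [C [ACB C0]] := envelope_sandwich M_combine M_finite AB0.
have {}ACB x : cube x -> A x <= C x <= B x.
  by move=> /hAB AB; have := ACB x; rewrite min_l// max_r.
exists C; split.
- move=> x cx; have /andP[A0 _] := hA x cx; have /andP[_ B1] := hB x cx.
  have /andP[ACx CBx] := ACB x cx.
  by rewrite (le_trans A0 ACx) (le_trans CBx B1).
(* On a one-box family, nonnegativity of the diagonal envelope is the inequality for that box. *)
- move=> Q kQ; have := C0 (family_mult k [:: Q]).
  rewrite envelope_diag big_seq1; apply; exists [:: Q] => // Q'.
  by rewrite inE => /eqP ->.
- by move=> x /ACB/andP[].
- by move=> x /ACB/andP[].
Qed.
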